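(* Let $N=\eta$, so that $\mathbb{S}_n=\{n\}$ for $n=1,\dots,\eta$. Given that the inputs are bounded, $x\in X=\prod_{i=1}^\eta[\underline{x}_i,\bar{x}_i]$, the formulation (P1)--(P5) represents the convex hull of the ReLU node: the set of all $(x,y)\in X\times[0,\infty)$ for which there exist $\sigma\in[0,1]$ and $z_1^b,\dots,z_\eta^b\in\mathbb{R}$ such that (P1)--(P5) hold is equal to $$\operatorname{conv}\{(x,y)\in X\times\mathbb{R} : y=\max(0,w^T x+b)\}.$$
   Context: Setting: fixed weights $w\in\mathbb{R}^\eta$, $b\in\mathbb{R}$, and a box $X=\prod_{i=1}^\eta[\underline{x}_i,\bar{x}_i]$ with $\underline{x}_i\le\bar{x}_i$ real. $\operatorname{conv}$ denotes convex hull. The $N$-partition formulation: $\{1,\dots,\eta\}$ is partitioned into pairwise disjoint nonempty sets $\mathbb{S}_1,\dots,\mathbb{S}_N$; the variables are $x\in X$, $y\in[0,\infty)$, $\sigma$ (binary, relaxed to $[0,1]$ in the continuous relaxation), $z_1^b,\dots,z_N^b\in\mathbb{R}$; the constraints are (P1) $\sum_{n=1}^N\big(\sum_{i\in\mathbb{S}_n}w_i x_i-z_n^b\big)+\sigma b\le 0$; (P2) $\sum_{n=1}^N z_n^b+(1-\sigma)b\ge 0$; (P3) $y=\sum_{n=1}^N z_n^b+(1-\sigma)b$; (P4) $\sigma\,\mathit{LB}_n^a\le\sum_{i\in\mathbb{S}_n}w_i x_i-z_n^b\le\sigma\,\mathit{UB}_n^a$ for $n=1,\dots,N$; (P5) $(1-\sigma)\,\mathit{LB}_n^b\le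 z_n^b\le(1-\sigma)\,\mathit{UB}_n^b$ for $n=1,\dots,N$. The bounds are the interval-arithmetic bounds over the box: $\mathit{LB}_n^a=\mathit{LB}_n^b=\sum_{i\in\mathbb{S}_n}\min(w_i\underline{x}_i,w_i\bar{x}_i)$ and $\mathit{UB}_n^a=\mathit{UB}_n^b=\sum_{i\in\mathbb{S}_n}\max(w_i\underline{x}_i,w_i\bar{x}_i)$. *)

(* Defs.v *)
From HB Require Import structures.
From mathcomp Require Import all_boot all_order all_algebra.
From mathcomp Require Import boolp classical_sets reals convex.

Set Implicit Arguments.
Unset Strict Implicit.
Unset Printing Implicit Defensive.

Import Order.TTheory GRing.Theory Num.Theory.

(* Partitions of the index set into N nonempty blocks, numbered by 'I_N.  The
   blocks are finite sets ({set _}), not classical sets. *)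
Record index_partition (eta N : nat) := IndexPartition {
  block :> 'I_N -> {set 'I_eta};
  block_nonempty : forall n, block n != finset.set0;
  block_disjoint : forall m n, m != n -> [disjoint block m & block n];
  block_cover : forall i, exists n, i \in block n
}.

Lemma singleton_nonempty (eta : nat) (n : 'I_eta) : [set n]%SET != finset.set0.
Proof. by apply/set0Pn; exists n; rewrite inE. Qed.

Lemma singleton_disjoint (eta : nat) (m n : 'I_eta) :
  m != n -> [disjoint [set m]%SET & [set n]%SET].
Proof. by move=> mn; rewrite disjoints1 inE. Qed.

Lemma singleton_cover (eta : nat) (i : 'I_eta) : exists n, i \in [set n]%SET.
Proof. by exists i; rewrite inE. Qed.

Definition singletons (eta : nat) : index_partition eta eta :=
  IndexPartition (@singleton_nonempty eta) (@singleton_disjoint eta)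
                 (@singleton_cover eta).

Local Open Scope classical_set_scope.
Local Open Scope ring_scope.

Definition convex_hull (R : numDomainType) (M : lmodType R) (A : set M) : set M :=
  smallest (@convex_set R M) A.

Section ReLUNode.
Variables (R : realType) (eta : nat).
Variables (w : 'cV[R]_eta) (b : R) (xl xu : 'cV[R]_eta).

Definition box : set 'cV[R]_eta :=
  [set x | forall i, xl i 0 <= x i 0 <= xu i 0].

(* R^o is R seen as a module over itself, so that the product is a module. *)
Definition relu_graph : set ('cV[R]_eta * R^o) :=
  [set p | box p.1 /\ p.2 = Num.max 0 ((w^T *m p.1) 0 0 + b)].

Definition LB (S : {set 'I_eta}) : R :=
  \sum_(i in S) Num.min (w i 0 * xl i 0) (w i 0 * xu i 0).

Definition UB (S : {set 'I_eta}) : R :=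
  \sum_(i in S) Num.max (w i 0 * xl i 0) (w i 0 * xu i 0).

Section Formulation.
Variables (N : nat) (S : index_partition eta N).

(* z n stands for the auxiliary variable z_n^b.  Interval arithmetic gives the
   same bounds LB, UB for both disjuncts (LB^a = LB^b and UB^a = UB^b). *)
Record feasible (x : 'cV[R]_eta) (y sigma : R) (z : 'I_N -> R) : Prop := Feasible {
  feasible_x : box x;
  feasible_y : 0 <= y;
  feasible_sigma : 0 <= sigma <= 1;
  feasible_P1 : \sum_n (\sum_(i in S n) w i 0 * x i 0 - z n) + sigma * b <= 0;
  feasible_P2 : \sum_n z n + (1 - sigma) * b >= 0;
  feasible_P3 : y = \sum_n z n + (1 - sigma) * b;
  feasible_P4 : forall n,
    sigma * LB (S n) <= \sum_(i in S n) w i 0 * x i 0 - z n <= sigma * UB (S n);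
  feasible_P5 : forall n,
    (1 - sigma) * LB (S n) <= z n <= (1 - sigma) * UB (S n)
}.

Definition relaxation : set ('cV[R]_eta * R^o) :=
  [set p | exists sigma z, feasible p.1 p.2 sigma z].

End Formulation.
End ReLUNode.

(* Main.v *)
Require Import Defs.
From mathcomp Require Import all_boot all_order all_algebra.
From mathcomp Require Import boolp classical_sets reals convex.
From mathcomp Require Import interval_inference ring lra.

Set Implicit Arguments.
Unset Strict Implicit.
Unset Printing Implicit Defensive.

Import Order.TTheory GRing.Theory Num.Theory.

Local Open Scope ring_scope.

(** The formulation is an extended description of a union of two polytopes: the
    inactive part of the ReLU graph (y = 0, w^T x + b <= 0) and the active part
    (y = w^T x + b >= 0), with sigma the weight of the inactive part.

    The relaxation contains the graph: inactive points are feasible with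
    sigma = 1 and z = 0, active points with sigma = 0 and z_n = w_n x_n
    ([relu_graph_relaxation]).  Its constraints are jointly affine in all the
    variables, so it is convex ([convex_relaxation]) and contains the convex
    hull of the graph.  Both facts hold for every partition.

    The singleton partition is what makes the converse true.  When
    0 < sigma < 1, a feasible point has to be written as
    x = sigma u + (1 - sigma) v with u and v in the box and
    z_n = (1 - sigma) w_n v_n.  With one coordinate per block, the numbers z_n
    and w_n x_n - z_n determine v_n and u_n whenever w_n <> 0, and the
    interval bounds (P4) and (P5) say exactly that u_n and v_n lie between the
    bounds of the box ([split_coordinate]).  Then (P1) and (P2) say that u is
    inactive and v is active, and (P3) that y = sigma 0 + (1 - sigma) (w^T v +
    b).  When sigma is 0 or 1 the point is itself on the graph. *)

(** * Convex combinations *)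

Lemma convex_setP (R : realType) (M : lmodType R) (A : set M) :
  @convex_set R M A <->
  forall (p q : M) (t : R), A p -> A q -> 0 < t -> t < 1 ->
    A (t *: p + (1 - t) *: q).
Proof.
split=> [/convex_setW cA p q t Ap Aq t0 t1|cA].
  have := cA p q (mem_set Ap) (mem_set Aq) (Itv01 (ltW t0) (ltW t1)) t0 t1.
  by move/set_mem.
apply/convex_setW => p q /set_mem Ap /set_mem Aq k k0 k1.
exact/mem_set/cA.
Qed.

Lemma ler_convex_comb (R : realDomainType) (t a1 a2 c1 c2 : R) :
  0 <= t <= 1 -> a1 <= c1 -> a2 <= c2 ->
  t * a1 + (1 - t) * a2 <= t * c1 + (1 - t) * c2.
Proof.
by case/andP=> t0 t1 ac1 ac2; apply: lerD; apply: ler_wpM2l; rewrite ?subr_ge0.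
Qed.

Lemma sumr_convex_comb (R : comPzRingType) (I : Type) (r : seq I) (P : pred I)
    (t : R) (f g : I -> R) :
  \sum_(i <- r | P i) (t * f i + (1 - t) * g i) =
  t * (\sum_(i <- r | P i) f i) + (1 - t) * (\sum_(i <- r | P i) g i).
Proof. by rewrite big_split /= -!mulr_sumr. Qed.

(** * The relaxation contains the convex hull *)

Lemma mul_itv_bounds (R : realDomainType) (c l u x : R) : l <= x <= u ->
  Num.min (c * l) (c * u) <= c * x <= Num.max (c * l) (c * u).
Proof.
case/andP=> lx xu'; rewrite ge_min le_max.
have [c0|/ltW c0] := leP 0 c.
  by rewrite (ler_wpM2l c0 lx) (ler_wpM2l c0 xu') orbT.
by rewrite (ler_wnM2l c0 lx) (ler_wnM2l c0 xu') orbT.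
Qed.

Section Relaxation.
Variables (R : realType) (eta : nat).
Variables (w : 'cV[R]_eta) (b : R) (xl xu : 'cV[R]_eta).

Lemma mulmx_tr_col (x : 'cV[R]_eta) :
  (w^T *m x) 0 0 = \sum_i w i 0 * x i 0.
Proof. by rewrite mxE; apply: eq_bigr => i _; rewrite mxE. Qed.

Section AnyPartition.
Variables (N : nat) (S : index_partition eta N).

Lemma convex_relaxation :
  @convex_set R ('cV[R]_eta * R^o)%type (relaxation w b xl xu S).
Proof.
apply/convex_setP => -[x1 y1] [x2 y2] t [s1 [z1 F1]] [s2 [z2 F2]] t0 t1.
have t01 : 0 <= t <= 1 by rewrite !ltW.
case: F1 => /= X1 Y1 /andP[s1l s1u] A1 B1 C1 D1 E1.
case: F2 => /= X2 Y2 /andP[s2l s2u] A2 B2 C2 D2 E2.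
exists (t * s1 + (1 - t) * s2), (fun n => t * z1 n + (1 - t) * z2 n).
have blockE n : \sum_(i in S n) w i 0 * (t *: x1 + (1 - t) *: x2) i 0 =
    t * (\sum_(i in S n) w i 0 * x1 i 0) +
    (1 - t) * (\sum_(i in S n) w i 0 * x2 i 0).
  by rewrite -sumr_convex_comb; apply: eq_bigr => i _; rewrite !mxE; ring.
split=> /=.
- move=> i; rewrite !mxE.
  have /andP[l1 u1] := X1 i; have /andP[l2 u2] := X2 i.
  have := ler_convex_comb t01 l1 l2.
  have := ler_convex_comb t01 u1 u2.
  by move=> hu hl; apply/andP; split; lra.
- by rewrite addr_ge0 // mulr_ge0 // ?subr_ge0 ltW.
- have := ler_convex_comb t01 s1l s2l.
  have := ler_convex_comb t01 s1u s2u.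
  by move=> hu hl; apply/andP; split; lra.
- have := ler_convex_comb t01 A1 A2.
  rewrite !mulr0 addr0; apply: le_trans; rewrite le_eqVlt; apply/orP; left.
  apply/eqP; rewrite !mulrDr addrACA -sumr_convex_comb; congr (_ + _);
    last ring.
  by apply: eq_bigr => n _; rewrite blockE; ring.
- have := ler_convex_comb t01 B1 B2.
  by rewrite !mulr0 addr0 sumr_convex_comb => h; lra.
- by rewrite sumr_convex_comb C1 C2 /GRing.scale /=; ring.
- move=> n; rewrite blockE.
  have /andP[l1 u1] := D1 n; have /andP[l2 u2] := D2 n.
  have := ler_convex_comb t01 l1 l2.
  have := ler_convex_comb t01 u1 u2.
  by move=> hu hl; apply/andP; split; lra.
- move=> n.
  have /andP[l1 u1] := E1 n; have /andP[l2 u2] := E2 n.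
  have := ler_convex_comb t01 l1 l2.
  have := ler_convex_comb t01 u1 u2.
  by move=> hu hl; apply/andP; split; lra.
Qed.

Lemma block_bounds (x : 'cV[R]_eta) (n : 'I_N) : box xl xu x ->
  LB w xl xu (S n) <= \sum_(i in S n) w i 0 * x i 0 <= UB w xl xu (S n).
Proof.
by move=> X; apply/andP; split; apply: ler_sum => i _;
  have /andP[] := mul_itv_bounds (w i 0) (X i).
Qed.

Lemma sum_blocks (f : 'I_eta -> R) :
  \sum_n \sum_(i in S n) f i = \sum_i f i.
Proof.
rewrite (exchange_big_dep xpredT) //=; apply: eq_bigr => i _.
have [n inn] := block_cover S i.
rewrite (big_pred1 n) // => m; apply/idP/eqP => [im|-> //].
apply/eqP/negP => /negP mn.
by have /pred0P/(_ i) := block_disjoint S mn; rewrite /= im inn.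
Qed.

Lemma relu_graph_relaxation :
  (relu_graph w b xl xu `<=` relaxation w b xl xu S)%classic.
Proof.
move=> [x y] [/= X ->]; rewrite mulmx_tr_col.
have [act|inact] := leP 0 (\sum_i w i 0 * x i 0 + b).
  exists 0, (fun n => \sum_(i in S n) w i 0 * x i 0).
  split=> //=; rewrite ?lexx ?ler01 ?sum_blocks ?subr0 ?mul1r //.
  - by rewrite big1 ?mul0r ?addr0 // => n _; rewrite subrr.
  - by move=> n; rewrite subrr !mul0r lexx.
  - by move=> n; rewrite !mul1r block_bounds.
exists 1, (fun=> 0).
split=> //=; rewrite ?lexx ?ler01 ?subrr ?mul0r ?big1_eq ?addr0 ?lexx //.
- by under eq_bigr do rewrite subr0; rewrite sum_blocks mul1r ltW.
- by move=> n; rewrite subr0 !mul1r block_bounds.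
- by move=> n; rewrite !mul0r lexx.
Qed.

End AnyPartition.
End Relaxation.

(** * Splitting a feasible point *)

(** For c <> 0 the interval spanned by c l and c u is the exact image of
    [l, u], so a bound scaled by s can be divided back by s c. *)
Lemma itv_of_scaled_bounds (R : realFieldType) (c l u s a : R) :
  c != 0 -> 0 < s -> l <= u ->
  s * Num.min (c * l) (c * u) <= a <= s * Num.max (c * l) (c * u) ->
  l <= a / (s * c) <= u.
Proof.
move=> c_neq0 s0 lu; have scE r : r * (s * c) = s * (c * r) by ring.
case: (ltgtP c 0) c_neq0 => // c0 _.
  rewrite min_r ?max_l ?(ler_wnM2l (ltW c0)) // => /andP[hl hu].
  have sc0 : s * c < 0 by rewrite pmulr_rlt0.
  by rewrite ler_ndivlMr // ler_ndivrMr // !scE hl hu.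
rewrite min_l ?max_r ?(ler_wpM2l (ltW c0)) // => /andP[hl hu].
have sc0 : 0 < s * c by rewrite mulr_gt0.
by rewrite ler_pdivlMr // ler_pdivrMr // !scE hl hu.
Qed.

(** A coordinate of weight c = 0 puts no constraint on its two parts, and
    forces z = 0: both parts can then be x itself. *)
Lemma split_coordinate (R : realFieldType) (c l u s x z : R) :
  0 < s < 1 -> l <= x <= u ->
  s * Num.min (c * l) (c * u) <= c * x - z <= s * Num.max (c * l) (c * u) ->
  (1 - s) * Num.min (c * l) (c * u) <= z <= (1 - s) * Num.max (c * l) (c * u) ->
  exists p : R * R, [/\ l <= p.1 <= u, l <= p.2 <= u,
    x = s * p.1 + (1 - s) * p.2 & z = (1 - s) * (c * p.2)].
Proof.
move=> /andP[s0 s1] lxu ha hb.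
have [c0|c_neq0] := eqVneq c 0.
  exists (x, x); split=> //=; first by ring.
  move: hb; rewrite c0 !mul0r minxx maxxx !mulr0.
  by move=> hz; apply/eqP; rewrite eq_le andbC.
have lu : l <= u by case/andP: lxu; apply: le_trans.
have s'0 : 0 < 1 - s by rewrite subr_gt0.
exists ((c * x - z) / (s * c), z / ((1 - s) * c)); split=> /=.
- exact: itv_of_scaled_bounds.
- exact: itv_of_scaled_bounds.
- by field; rewrite c_neq0 !gt_eqF.
- by field; rewrite c_neq0 gt_eqF.
Qed.

Section Splitting.
Variables (R : realType) (eta : nat).
Variables (w : 'cV[R]_eta) (b : R) (xl xu : 'cV[R]_eta).

Lemma feasible_split (x : 'cV[R]_eta) (y s : R) (z : 'I_eta -> R) :
  0 < s < 1 -> feasible w b xl xu (singletons eta) x y s z ->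
  exists u v : 'cV[R]_eta, [/\ box xl xu u, box xl xu v,
    x = s *: u + (1 - s) *: v &
    forall i, z i = (1 - s) * (w i 0 * v i 0)].
Proof.
move=> s01 [X _ _ _ _ _ D E].
have split_at i : exists p : R * R,
    [/\ xl i 0 <= p.1 <= xu i 0, xl i 0 <= p.2 <= xu i 0,
    x i 0 = s * p.1 + (1 - s) * p.2 & z i = (1 - s) * (w i 0 * p.2)].
  move: (D i) (E i); rewrite /LB /UB /= !big_set1.
  exact: split_coordinate.
have [p pP] := choice split_at.
exists (\col_i (p i).1), (\col_i (p i).2); split.
- by move=> i; rewrite mxE; case: (pP i).
- by move=> i; rewrite mxE; case: (pP i).
- by apply/colP => i; rewrite !mxE; case: (pP i).
- by move=> i; rewrite mxE; case: (pP i).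
Qed.

Lemma relaxation_sub_convex_hull :
  (relaxation w b xl xu (singletons eta) `<=`
   convex_hull (relu_graph w b xl xu))%classic.
Proof.
move=> [x y] [s [z F]] A [/convex_setP cA GA].
have {}F : feasible w b xl xu (singletons eta) x y s z := F.
have [X Y /andP[s0 s1] P1 P2 P3 P4 P5] := F.
have activeP u : box xl xu u -> 0 <= \sum_i w i 0 * u i 0 + b ->
    A (u, \sum_i w i 0 * u i 0 + b : R^o).
  by move=> U act; apply: GA; split=> //=; rewrite mulmx_tr_col max_r.
have inactiveP u : box xl xu u -> \sum_i w i 0 * u i 0 + b <= 0 ->
    A (u, 0 : R^o).
  by move=> U inact; apply: GA; split=> //=; rewrite mulmx_tr_col max_l.
move: P1; rewrite sumrB sum_blocks => P1.
move: s0; rewrite le_eqVlt => /predU1P[s0|s0].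
  (* sigma = 0: (P4) forces z_n = w_n x_n. *)
  have zE : \sum_n z n = \sum_i w i 0 * x i 0.
    rewrite -[RHS](sum_blocks (singletons eta)); apply: eq_bigr => n _.
    by move: (P4 n); rewrite -s0 !mul0r -eq_le eq_sym subr_eq0 => /eqP.
  by move: P2; rewrite P3 zE -s0 subr0 mul1r; apply: activeP.
move: s1; rewrite le_eqVlt => /predU1P[s1|s1].
  (* sigma = 1: (P5) forces z = 0. *)
  have zE : \sum_n z n = 0.
    by apply: big1 => n _; move: (P5 n); rewrite s1 subrr !mul0r -eq_le => /eqP.
  move: P1; rewrite P3 zE s1 subrr mul0r subr0 mul1r addr0.
  exact: inactiveP.
have [|u [v [U V xE zE]]] := feasible_split _ F; first by rewrite s0 s1.
have sumz : \sum_n z n = (1 - s) * \sum_i w i 0 * v i 0.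
  by rewrite mulr_sumr; apply: eq_bigr => i _.
have sumx : \sum_i w i 0 * x i 0 =
    s * (\sum_i w i 0 * u i 0) + (1 - s) * \sum_i w i 0 * v i 0.
  by rewrite -sumr_convex_comb; apply: eq_bigr => i _; rewrite xE !mxE; ring.
have -> : (x, y) = s *: (u, 0 : R^o) +
    (1 - s) *: (v, \sum_i w i 0 * v i 0 + b : R^o).
  congr (_, _); first by [].
  by rewrite P3 sumz /= /GRing.scale /=; ring.
apply: cA => //.
- apply: inactiveP => //; rewrite -(pmulr_rle0 _ s0).
  by move: P1; rewrite sumx sumz => P1; lra.
- apply: activeP => //; rewrite -(@pmulr_rge0 _ (1 - s)) ?subr_gt0 //.
  by move: P2; rewrite sumz mulrDr.
Qed.

End Splitting.

Theorem proposition3 (R : realType) (eta : nat) (w : 'cV[R]_eta) (b : R)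
    (xl xu : 'cV[R]_eta) (hx : forall i, xl i 0 <= xu i 0) :
  relaxation w b xl xu (singletons eta) = convex_hull (relu_graph w b xl xu).
Proof.
apply/seteqP; split; first exact: relaxation_sub_convex_hull.
apply: smallest_sub; first exact: convex_relaxation.
exact: relu_graph_relaxation.
Qed.
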